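(* Let $r,n\ge2$ be two integers, let $\mathtt s=(s_1,\dots,s_{n-1})\in\mathbb N^{n-1}$ with $1\le s_i\le r-1$ for all $i=1,\dots,n-1$, and let $h$ be a function of class $C_b^{2r-1}$ around the origin of $\mathbb R^n$ satisfying $\nabla h(0)\ne0$. Then, for any given $m\in\{2,\dots,n-1\}$, $h$ is steep at the origin, with index $\boldsymbol\alpha_m=1$, on the $m$-dimensional subspaces belonging to $\mathsf\Lambda_0(h,m,n)$.
   Context: $\mathtt G(m,n)$ is the Grassmannian of $m$-dimensional linear subspaces of $\mathbb R^n$. $\mathsf\Lambda_0(h,m,n)$ is the set of $\Gamma^m\in\mathtt G(m,n)$ such that $\nabla h(0)\perp\Gamma^m$ and the Hessian matrix at the origin of the restriction of $h$ to $\Gamma^m$ has no null eigenvalue. $C_b^{q}$ around the origin: $C^q$ with bounded derivatives up to order $q$ on some ball centered at $0$. $h$ is steep at the origin on a given $m$-dimensional subspace $\Gamma^m\perp\nabla h(0)$ with index $\boldsymbol\alpha_m$ if there are constants $C_m,\delta>0$ (allowed to depend on $\Gamma^m$) such that $\max_{0\le\eta\le\xi}\min_{u\in\Gamma^m,\|u\|_2=\eta}\|\pi_{\Gamma^m}\nabla h(u)\|>C_m\xi^{\boldsymbol\alpha_m}$ for all $\xi\in(0,\delta]$, where $\pi_{\Gamma^m}$ is the orthogonal projection on $\Gamma^m$. *)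

(* Defs.v *)
From HB Require Import structures.
From mathcomp Require Import all_boot all_order all_algebra.
From mathcomp Require Import all_classical all_reals all_analysis.
Set Implicit Arguments.
Unset Strict Implicit.
Unset Printing Implicit Defensive.
Import Order.TTheory GRing.Theory Num.Theory.
Import numFieldNormedType.Exports.
Local Open Scope classical_set_scope.
Local Open Scope ring_scope.

Section Steepness.
Context {R : realType}.

Definition dotp n (u v : 'rV[R]_n) : R := \sum_i u 0 i * v 0 i.

(* The library norm `|u| on 'rV[R]_n is the sup norm; the Euclidean norm
   induces the same topology. *)
Definition enorm n (u : 'rV[R]_n) : R := Num.sqrt (dotp u u).

Definition pderiv n (i : 'I_n) (f : 'rV[R]_n -> R) : 'rV[R]_n -> R :=
  fun x => 'D_(delta_mx 0 i) f x.

Definition pderivs n (l : seq 'I_n) (f : 'rV[R]_n -> R) : 'rV[R]_n -> R :=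
  foldr (@pderiv n) f l.

(* C_b^q around the origin: on some ball centered at 0, all the iterated partial
   derivatives of f of order at most q exist, are continuous and are bounded.
   No assumption is made on f outside that ball. *)
Definition Cb_around0 n (q : nat) (f : 'rV[R]_n -> R) : Prop :=
  exists2 rho : R, 0 < rho &
    forall l : seq 'I_n, (size l <= q)%N ->
    [/\ (size l < q)%N -> forall (i : 'I_n) (x : 'rV[R]_n), enorm x < rho ->
          derivable (pderivs l f) x (delta_mx 0 i),
        forall x : 'rV[R]_n, enorm x < rho -> {for x, continuous (pderivs l f)}
      & exists M : R, forall x : 'rV[R]_n, enorm x < rho ->
          `|pderivs l f x| <= M].

Definition gradient n (f : 'rV[R]_n -> R) (x : 'rV[R]_n) : 'rV[R]_n :=
  \row_i pderiv i f x.

Definition hessian n (f : 'rV[R]_n -> R) (x : 'rV[R]_n) : 'M[R]_n :=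
  \matrix_(i, j) pderiv i (pderiv j f) x.

Definition orth_to n (v : 'rV[R]_n) (G : {vspace 'rV[R]_n}) : Prop :=
  forall u : 'rV[R]_n, u \in G -> dotp v u = 0.

(* Orthogonal projection on G: the unique p in G such that v - p is orthogonal
   to G. *)
Definition orth_proj n (G : {vspace 'rV[R]_n}) (v : 'rV[R]_n) : 'rV[R]_n :=
  get [set p : 'rV[R]_n | p \in G /\ orth_to (v - p) G].

Definition Grassmannian (m n : nat) : set {vspace 'rV[R]_n} :=
  [set G | \dim G = m].

Definition orthonormal_basis n m (G : {vspace 'rV[R]_n})
    (b : m.-tuple 'rV[R]_n) : Prop :=
  basis_of G b /\ forall i j : 'I_m, dotp (tnth b i) (tnth b j) = (i == j)%:R.

(* The restriction of f to the span of b, read in the coordinates given by b. *)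
Definition restriction n m (f : 'rV[R]_n -> R) (b : m.-tuple 'rV[R]_n) :
    'rV[R]_m -> R :=
  fun t => f (\sum_i t 0 i *: tnth b i).

(* The Hessian matrix of the restriction of f to G is taken in an orthonormal
   basis of G; its spectrum does not depend on the choice of that basis. *)
Definition Lambda0 n (f : 'rV[R]_n -> R) (m : nat) : set {vspace 'rV[R]_n} :=
  [set G | [/\ Grassmannian m G, orth_to (gradient f 0) G &
     exists2 b : m.-tuple 'rV[R]_n, orthonormal_basis G b &
       ~~ eigenvalue (hessian (restriction f b) 0) 0]].

(* The minimum and the maximum in the definition of steepness are written with
   inf and sup: for f of class C^1 around 0 and xi small, both are attained. *)
Definition min_proj_grad n (f : 'rV[R]_n -> R) (G : {vspace 'rV[R]_n})
    (eta : R) : R :=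
  inf [set enorm (orth_proj G (gradient f u)) |
        u in [set u : 'rV[R]_n | u \in G /\ enorm u = eta]].

(* Steepness at the origin on G with index alpha; C and delta may depend on G. *)
Definition steep_on n (f : 'rV[R]_n -> R) (G : {vspace 'rV[R]_n})
    (alpha : R) : Prop :=
  orth_to (gradient f 0) G /\
  exists C delta : R, [/\ 0 < C, 0 < delta &
    forall xi : R, 0 < xi <= delta ->
      C * xi `^ alpha <
        sup [set min_proj_grad f G eta | eta in [set eta : R | 0 <= eta <= xi]]].

End Steepness.

(* Main.v *)
From HB Require Import structures.
Require Import Defs.
From mathcomp Require Import all_boot all_order all_algebra.
From mathcomp Require Import all_classical all_reals all_analysis.
From mathcomp Require Import ring lra.
Set Implicit Arguments.
Unset Strict Implicit.
Unset Printing Implicit Defensive.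
Import Order.TTheory GRing.Theory Num.Theory.
Import numFieldNormedType.Exports.
Local Open Scope classical_set_scope.
Local Open Scope ring_scope.

(** The proof rests on the first-order expansion of the gradient of [h] at
[0]. In an orthonormal basis [b] of [G], the coordinates of the projection
on [G] of the gradient at [u] are its scalar products with the vectors of
[b]. They vanish at [u = 0], and their differential at [0] along [G] is
the Hessian matrix [H] of the restriction of [h] to [G]; so for [u] in [G]
with coordinates [t] they are equal to [t *m H] up to [o(|u|)]
([grad_onb_expansion]). Since [0] is not an eigenvalue, [H] is invertible
and [t *m H] has norm at least a constant times [|u|], a bound which
survives the [o(|u|)] ([enorm_proj_grad_ge]).

This lower bound holds on each whole sphere of [G] of small radius, hence for
the minimum over it, and the maximum over [0 <= eta <= xi] is at least the
value at [eta = xi]: the index is 1 ([steep_on_of_linear_bound]). An infimum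
is at least a lower bound only over a nonempty set, and a supremum is at least
a member only of a bounded set: this is where a unit vector of [G] and the
bound on the first derivatives ([enorm_proj_grad_le]) come in.

The passage from the partial derivatives in [Cb_around0] to differentials is
the classical theorem that a function with continuous partial derivatives is
differentiable ([continuous_pderiv_differentiable]). *)

(** * Directional derivatives and differentiability *)

(** The difference quotients of [f \o A] along [v] and of [f] along [w] are
the same function, whether or not they converge. *)
Lemma derive_comp_affine (R : numFieldType) (U V W : normedModType R)
    (f : V -> W) (A : U -> V) (x v : U) (w : V)
    (hA : forall s : R, A (s *: v + x) = s *: w + A x) :
  'D_v (f \o A) x = 'D_w f (A x).
Proof.
rewrite /derive; set g := (X in lim (X @ _)) ; set g2 := (X in _ = lim (X @ _)).
by rewrite (_ : g = g2) //; apply: funext => s; rewrite /g /g2 /= hA.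
Qed.

Lemma derivable_comp_affine (R : numFieldType) (U V W : normedModType R)
    (f : V -> W) (A : U -> V) (x v : U) (w : V)
    (hA : forall s : R, A (s *: v + x) = s *: w + A x) :
  derivable f (A x) w -> derivable (f \o A) x v.
Proof.
rewrite /derivable; set g := (X in cvg (X @ _)).
set g2 := (X in _ -> cvg (X @ _)).
by rewrite (_ : g = g2) //; apply: funext => s; rewrite /g /g2 /= hA.
Qed.

(** [a] may be negative: this is the form needed to compare [f] at two points
that differ by an arbitrary multiple of a basis vector. *)
Lemma MVT_line (R : realType) (V : normedModType R) (f : V -> R) (y e : V)
    (a : R) (df : forall s, `|s| <= `|a| -> derivable f (s *: e + y) e) :
  exists2 s, `|s| <= `|a| & f (a *: e + y) - f y = a * 'D_e f (s *: e + y).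
Proof.
pose A (s : R) : V := s *: e + y.
have hA (x s : R) : A (s *: (1 : R) + x) = s *: e + A x.
  by rewrite /A [s *: 1]mulr1 scalerDl addrA.
have dA (s : R) : `|s| <= `|a| -> is_derive s 1 (f \o A) ('D_e f (A s)).
  move=> sa; apply: DeriveDef; last exact: derive_comp_affine.
  by apply: (@derivable_comp_affine _ _ _ _ _ _ _ _ e) => //; apply: df.
have cA (b c : R) : (forall s, s \in `[b, c] -> `|s| <= `|a|) ->
    {within `[b, c], continuous (f \o A)}.
  move=> bc; apply: derivable_within_continuous => s /bc sa.
  by have [] := dA s sa.
case: (leP 0 a) => a0.
  have sub s : s \in `[0, a] -> `|s| <= `|a|.
    by rewrite in_itv /= => /andP[s0 sa]; rewrite !ger0_norm.
  have [||s sa eq_f] := @MVT_segment R (f \o A) (fun s => 'D_e f (A s)) 0 a a0.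
  - by move=> s sa; apply/dA/sub/(subset_itv_oo_cc sa).
  - exact: cA.
  exists s; first exact: sub.
  by move: eq_f; rewrite /= /A scale0r add0r subr0 mulrC.
have sub s : s \in `[a, 0] -> `|s| <= `|a|.
  rewrite in_itv /= => /andP[sa s0].
  by rewrite !ler0_norm ?lerN2 // ltW.
have [||s sa eq_f] :=
  @MVT_segment R (f \o A) (fun s => 'D_e f (A s)) a 0 (ltW a0).
- by move=> s sa; apply/dA/sub/(subset_itv_oo_cc sa).
- exact: cA.
exists s; first exact: sub.
move: eq_f; rewrite /= /A scale0r add0r => /(congr1 -%R).
by rewrite opprB => ->; ring.
Qed.

Lemma coord_le_norm (R : realType) n (u : 'rV[R]_n) i : `|u 0 i| <= `|u|.
Proof.
rewrite [leRHS]/Num.norm /= mx_normrE.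
by apply: le_trans (le_bigmax _ _ (0, i)).
Qed.

Lemma norm_le_coord (R : realType) n (u : 'rV[R]_n) (c : R) :
  0 <= c -> (forall i, `|u 0 i| <= c) -> `|u| <= c.
Proof.
move=> c0 uc; rewrite [leLHS]/Num.norm /= mx_normrE.
by apply/bigmax_leP; split=> // -[j i] _ /=; rewrite ord1.
Qed.

Lemma differentiable_lincomb (R : numFieldType) (V : normedModType R) n
    (f : 'I_n -> V -> R) (c : 'I_n -> R) (x : V) :
  (forall i, differentiable (f i) x) ->
  differentiable (fun y => \sum_i f i y * c i) x.
Proof.
move=> df; rewrite (_ : (fun _ => _) = \sum_i (fun y => f i y * c i)).
  by apply: differentiable_sum => i; apply: differentiableM.
by apply/funext => y; rewrite fct_sumE.
Qed.

(** Stating the expansion with explicit bounds lets it be proved by estimates;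
the differential chosen by the library is then [df], by uniqueness. *)
Lemma differentiable_of_expansion (R : numFieldType) (V W : normedModType R)
    (f : V -> W) (df : {linear V -> W}) (x : V) :
  continuous df ->
  (forall eps, 0 < eps ->
     \forall v \near (0 : V), `|f (v + x) - f x - df v| <= eps * `|v|) ->
  differentiable f x.
Proof.
move=> df_cont f_exp.
have expand : f \o shift x = cst (f x) + df +o_ 0 id.
  apply/eqaddoP => eps /f_exp; apply: filterS => v.
  by rewrite -addrA -opprD.
by apply/diff_locallyP; rewrite (diff_unique df_cont expand).
Qed.

(** One moves from [x] to [v + x] by changing one coordinate at a time. By the
mean value theorem, changing the [k]-th one adds [v 0 k] times a value of
the [k]-th partial derivative at a point no farther from [x] than [|v|] in
the sup norm, and by continuity this value is close to the one at [x]. *)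
Lemma continuous_pderiv_differentiable (R : realType) n (f : 'rV[R]_n -> R)
    (x : 'rV[R]_n) :
  (\forall y \near x, forall i, derivable f y (delta_mx 0 i)) ->
  (forall i, {for x, continuous (pderiv i f)}) ->
  differentiable f x.
Proof.
move=> f_der f_cont.
pose L (v : 'rV[R]_n) : R := \sum_i v 0 i * pderiv i f x.
have L_lin : linear L.
  move=> a u v; rewrite /L scaler_sumr -big_split /=; apply: eq_bigr => i _.
  by rewrite !mxE mulrDl -mulrA.
pose LM := GRing.isLinear.Build _ _ _ _ _ L_lin.
pose df : {linear 'rV[R]_n -> R} := HB.pack L LM.
have df_cont : continuous df.
  move=> v; apply: differentiable_continuous.
  by apply: differentiable_lincomb => i; apply: differentiable_coord.
apply: (@differentiable_of_expansion R _ _ f df x df_cont) => eps eps0.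
(* The [n] steps share the error [eps]; [n.+1] avoids dividing by zero. *)
have eps'0 : 0 < eps / n.+1%:R by rewrite divr_gt0.
have : \forall y \near x, (forall i, derivable f y (delta_mx 0 i)) /\
    forall i, `|pderiv i f x - pderiv i f y| <= eps / n.+1%:R.
  apply: filterI => //.
  have near_i i : \forall y \near x,
      `|pderiv i f x - pderiv i f y| <= eps / n.+1%:R.
    by have /cvgrPdist_le := f_cont i; apply.
  apply: (@filter_forall _ 'I_n
    (fun i y => `|pderiv i f x - pderiv i f y| <= eps / n.+1%:R)
    (nbhs x) _ near_i).
case/nbhs_ballP => d /= d0 near_x.
apply/nbhs_ballP; exists d => //= v.
rewrite -ball_normE /= sub0r normrN => vd.
(* The first [k] coordinates of [v], followed by zeros. *)
pose w (k : nat) : 'rV[R]_n := \row_i (if (i < k)%N then v 0 i else 0).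
have ball_x (y : 'rV[R]_n) : (forall i, `|y 0 i| <= `|v|) -> ball x d (y + x).
  move=> yv; rewrite -ball_normE /= opprD addrCA subrr addr0 normrN.
  by apply: le_lt_trans vd; apply: norm_le_coord.
have f_tele : f (v + x) - f x =
    \sum_(k < n) (f (w k.+1 + x) - f (w k + x)).
  rewrite -(big_mkord xpredT (fun k => f (w k.+1 + x) - f (w k + x))).
  rewrite (telescope_sumr (fun k => f (w k + x))) //; congr (f _ - f _).
    by congr (_ + _); apply/rowP => i; rewrite mxE ltn_ord.
  by rewrite (_ : w 0%N = 0) ?add0r //; apply/rowP => i; rewrite !mxE.
have step (k : 'I_n) :
    `|f (w k.+1 + x) - f (w k + x) - v 0 k * pderiv k f x|
      <= `|v| * (eps / n.+1%:R).
  have -> : w k.+1 = v 0 k *: delta_mx 0 k + w k.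
    apply/rowP => i; rewrite !mxE eqxx /= ltnS.
    case: (ltngtP i k) => [ik|ik|/val_inj ->]; rewrite ?eqxx ?mulr1 ?addr0 //.
      by rewrite (_ : i == k = false) ?mulr0 ?add0r // -val_eqE ltn_eqF.
    by rewrite (_ : i == k = false) ?mulr0 ?add0r // -val_eqE gtn_eqF.
  have in_ball s : `|s| <= `|v 0 k| -> ball x d (s *: delta_mx 0 k + (w k + x)).
    move=> sv; rewrite addrA; apply: ball_x => i; rewrite !mxE eqxx /=.
    case: (ltngtP i k) => [ik|ik|/val_inj ->].
    - rewrite (_ : i == k = false) ?mulr0 ?add0r ?coord_le_norm //.
      by rewrite -val_eqE ltn_eqF.
    - rewrite (_ : i == k = false) ?mulr0 ?add0r ?normr0 //.
      by rewrite -val_eqE gtn_eqF.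
    by rewrite eqxx mulr1 addr0 (le_trans sv) // coord_le_norm.
  have [s sv] := @MVT_line R _ f (w k + x) (delta_mx 0 k) (v 0 k)
    (fun s sv => (near_x _ (in_ball s sv)).1 k).
  rewrite addrA => ->; rewrite -mulrBr normrM distrC.
  rewrite ler_pM ?coord_le_norm //.
  by have [_] := near_x _ (in_ball s sv); apply.
rewrite /= f_tele /L -sumrB (le_trans (ler_norm_sum _ _ _)) //.
apply: le_trans (_ : \sum_(k < n) `|v| * (eps / n.+1%:R) <= _).
  by apply: ler_sum => k _; apply: step.
rewrite sumr_const card_ord -mulrnAr [leRHS]mulrC ler_wpM2l //.
rewrite -[leRHS](@divfK _ n.+1%:R) // -mulr_natr.
by rewrite ler_wpM2l ?ler_nat // ltW.
Qed.

(** * The Euclidean norm *)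

Lemma dotpC (R : realType) n (u v : 'rV[R]_n) : dotp u v = dotp v u.
Proof. by apply: eq_bigr => i _; rewrite mulrC. Qed.

Lemma dotpBl (R : realType) n (u v w : 'rV[R]_n) :
  dotp (u - v) w = dotp u w - dotp v w.
Proof. by rewrite /dotp -sumrB; apply: eq_bigr => i _; rewrite !mxE mulrBl. Qed.

Lemma dotpZl (R : realType) n (a : R) (u w : 'rV[R]_n) :
  dotp (a *: u) w = a * dotp u w.
Proof.
by rewrite /dotp mulr_sumr; apply: eq_bigr => i _; rewrite mxE mulrA.
Qed.

Lemma dotp_suml (R : realType) n m (u : 'I_m -> 'rV[R]_n) (w : 'rV[R]_n) :
  dotp (\sum_i u i) w = \sum_i dotp (u i) w.
Proof.
rewrite /dotp exchange_big /=; apply: eq_bigr => k _.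
by rewrite summxE mulr_suml.
Qed.

Lemma enorm_ge0 (R : realType) n (u : 'rV[R]_n) : 0 <= enorm u.
Proof. exact: sqrtr_ge0. Qed.

Lemma enorm0 (R : realType) n : enorm (0 : 'rV[R]_n) = 0.
Proof. by rewrite /enorm /dotp big1 ?sqrtr0 // => i _; rewrite mxE mul0r. Qed.

Lemma coord_le_enorm (R : realType) n (u : 'rV[R]_n) i : `|u 0 i| <= enorm u.
Proof.
rewrite -sqrtr_sqr ler_wsqrtr // /dotp (bigD1 i) //= expr2 lerDl.
by apply: sumr_ge0 => k _; rewrite -expr2 sqr_ge0.
Qed.

Lemma norm_le_enorm (R : realType) n (u : 'rV[R]_n) : `|u| <= enorm u.
Proof. by apply: norm_le_coord; [exact: enorm_ge0|exact: coord_le_enorm]. Qed.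

Lemma enorm_le_sum (R : realType) n (u : 'rV[R]_n) :
  enorm u <= \sum_i `|u 0 i|.
Proof.
have s0 : 0 <= \sum_i `|u 0 i| by apply: sumr_ge0.
rewrite -[leRHS]ger0_norm // -sqrtr_sqr ler_wsqrtr // expr2 mulr_suml.
apply: ler_sum => i _; rewrite (le_trans (ler_norm _)) // normrM.
by rewrite ler_wpM2l // (bigD1 i) //= lerDl sumr_ge0.
Qed.

(** The Euclidean balls in [Cb_around0] are neighbourhoods for the sup norm. *)
Lemma enorm_continuous (R : realType) n : continuous (@enorm R n).
Proof.
move=> u; apply: (@continuous_comp _ _ _ (fun v => dotp v v) Num.sqrt).
  apply: differentiable_continuous.
  rewrite (_ : (fun _ => _) =
      \sum_i (fun v : 'rV[R]_n => v 0 i * v 0 i)); last first.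
    by apply/funext => v; rewrite fct_sumE.
  apply: differentiable_sum => i.
  by apply: differentiableM; apply: differentiable_coord.
exact: sqrt_continuous.
Qed.

Lemma near_enorm_lt (R : realType) n (u : 'rV[R]_n) (rho : R) :
  enorm u < rho -> \forall v \near u, enorm v < rho.
Proof. exact: (@cvgr_lt _ _ _ _ _ _ (@enorm_continuous R n u)). Qed.

(** [0] is not an eigenvalue, so [H] is invertible, and [t] is recovered from
[t *m H] by [invmx H], whose entries give the constant. *)
Lemma enorm_le_mulmx (R : realType) m (H : 'M[R]_m) :
  ~~ eigenvalue H 0 ->
  exists2 c : R, 0 < c & forall t : 'rV[R]_m, enorm t <= c * enorm (t *m H).
Proof.
rewrite /eigenvalue /eigenspace negbK raddf0 subr0 kermx_eq0 row_free_unit.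
move=> uH; pose K := \sum_i \sum_j `|invmx H j i|.
exists (1 + K) => [|t].
  by rewrite ltr_pwDl // sumr_ge0 // => i _; rewrite sumr_ge0.
have {1}-> : t = t *m H *m invmx H by rewrite mulmxK.
apply: le_trans (enorm_le_sum _) _.
apply: le_trans (_ : K * enorm (t *m H) <= _); last first.
  by rewrite ler_wpM2r ?enorm_ge0 // lerDr.
rewrite /K mulr_suml; apply: ler_sum => i _; rewrite mxE mulr_suml.
apply: le_trans (ler_norm_sum _ _ _) _; apply: ler_sum => j _.
by rewrite normrM mulrC ler_wpM2l // coord_le_enorm.
Qed.

(** * The gradient and its components on a subspace *)

Lemma Cb_around0_C2 (R : realType) n q (f : 'rV[R]_n -> R) :
  (2 <= q)%N -> Cb_around0 q f ->
  exists rho : R, [/\ 0 < rho,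
    forall x, enorm x < rho -> differentiable f x,
    forall i x, enorm x < rho -> differentiable (pderiv i f) x
    & exists M : R, forall i x, enorm x < rho -> `|pderiv i f x| <= M].
Proof.
move=> q2 [rho rho0 f_Cb]; exists rho.
have diffl (l : seq 'I_n) x : (size l < q)%N -> enorm x < rho ->
    differentiable (pderivs l f) x.
  move=> lq x_rho; apply: continuous_pderiv_differentiable.
    apply: filterS (near_enorm_lt x_rho) => y y_rho i.
    by have [/(_ lq) + _ _] := f_Cb l (ltnW lq); apply.
  by move=> i; have [_ + _] := f_Cb (i :: l) lq; apply.
split=> //.
- by move=> x; apply: (diffl [::]); apply: leq_trans q2.
- by move=> i x; apply: (diffl [:: i]).
have bound i : exists M : R, forall x, enorm x < rho -> `|pderiv i f x| <= M.
  by have [_ _] := f_Cb [:: i] (ltnW q2).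
have [M hM] := choice bound.
exists (\sum_i `|M i|) => i x /(hM i) /le_trans; apply.
by rewrite (bigD1 i) //= (le_trans (ler_norm _)) // lerDl sumr_ge0.
Qed.

Lemma derive_dotp_gradient (R : realType) n (f : 'rV[R]_n -> R)
    (x v : 'rV[R]_n) :
  differentiable f x -> 'D_v f x = dotp (gradient f x) v.
Proof.
move=> df; rewrite deriveE // [X in 'd f x X]row_sum_delta linear_sum /=.
apply: eq_bigr => i _; rewrite linearZ /= mxE /pderiv deriveE // mulrC.
by [].
Qed.

Section OrthonormalBasis.
Context (R : realType) (n m : nat) (G : {vspace 'rV[R]_n}).
Context (b : m.-tuple 'rV[R]_n) (hb : orthonormal_basis G b).

Lemma onb_mem (i : 'I_m) : tnth b i \in G.
Proof. by case: hb => bG _; apply: (basis_mem bG); apply: mem_tnth. Qed.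

Lemma comb_mem (t : 'rV[R]_m) : \sum_i t 0 i *: tnth b i \in G.
Proof. by apply: memv_suml => i _; rewrite memvZ // onb_mem. Qed.

Lemma dotp_comb (c : 'I_m -> R) (j : 'I_m) :
  dotp (\sum_i c i *: tnth b i) (tnth b j) = c j.
Proof.
rewrite dotp_suml (bigD1 j) //= dotpZl (proj2 hb) eqxx mulr1.
by rewrite big1 ?addr0 // => i /negbTE ij; rewrite dotpZl (proj2 hb) ij mulr0.
Qed.

Lemma onb_decomp (u : 'rV[R]_n) :
  u \in G -> u = \sum_i dotp u (tnth b i) *: tnth b i.
Proof.
move=> uG; have uE : u = \sum_i coord b i u *: tnth b i.
  rewrite {1}(coord_basis (proj1 hb) uG); apply: eq_bigr => i _.
  by rewrite (tnth_nth 0).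
rewrite {1}uE; apply: eq_bigr => i _; congr (_ *: _).
by rewrite [in RHS]uE dotp_comb.
Qed.

Lemma enorm_comb (t : 'rV[R]_m) : enorm (\sum_i t 0 i *: tnth b i) = enorm t.
Proof.
rewrite /enorm [in LHS]dotp_suml; congr (Num.sqrt _).
by apply: eq_bigr => i _; rewrite dotpZl dotpC dotp_comb.
Qed.

(** The sum on the right meets the specification of the projection, so the
chosen vector meets it too, and its coordinates in [b] are then forced. *)
Lemma orth_proj_onb (v : 'rV[R]_n) :
  orth_proj G v = \sum_i dotp v (tnth b i) *: tnth b i.
Proof.
have [pG p_orth] : orth_proj G v \in G /\ orth_to (v - orth_proj G v) G.
  apply: (@getPex _ [set p | p \in G /\ orth_to (v - p) G]).
  exists (\sum_i dotp v (tnth b i) *: tnth b i); split.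
    by apply: memv_suml => i _; rewrite memvZ // onb_mem.
  move=> u /onb_decomp ->; rewrite dotpC dotp_suml big1 // => i _.
  by rewrite dotpZl [dotp (tnth b i) _]dotpC dotpBl dotp_comb subrr mulr0.
rewrite [LHS](onb_decomp pG); apply: eq_bigr => i _; congr (_ *: _).
by apply/esym/eqP; rewrite -subr_eq0 -dotpBl p_orth // onb_mem.
Qed.

Lemma enorm_orth_proj (v : 'rV[R]_n) :
  enorm (orth_proj G v) = enorm (\row_i dotp v (tnth b i)).
Proof.
rewrite orth_proj_onb -enorm_comb; congr enorm.
by apply: eq_bigr => i _; rewrite mxE.
Qed.

Lemma pderiv_restriction (f : 'rV[R]_n -> R) (i : 'I_m) (t : 'rV[R]_m) :
  pderiv i (restriction f b) t =
  'D_(tnth b i) f (\sum_k t 0 k *: tnth b k).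
Proof.
rewrite /pderiv; pose A (t : 'rV[R]_m) := \sum_k t 0 k *: tnth b k.
rewrite -[RHS](@derive_comp_affine _ _ _ _ f A t (delta_mx 0 i)) // => s.
rewrite /A.
have -> : s *: tnth b i = \sum_k (s *: delta_mx 0 i : 'rV_m) 0 k *: tnth b k.
  rewrite (bigD1 i) //= !mxE !eqxx mulr1 big1 ?addr0 // => k /negbTE ki.
  by rewrite !mxE ki andbF mulr0 scale0r.
by rewrite -big_split; apply: eq_bigr => k _; rewrite mxE scalerDl.
Qed.

(** Near [0] the [j]-th partial derivative of the restriction is itself the
restriction of the [j]-th coordinate of the gradient, which can thus be
differentiated once more. *)
Lemma hessian_restriction (f : 'rV[R]_n -> R) :
  (\forall x \near (0 : 'rV[R]_n), differentiable f x) ->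
  forall i j, hessian (restriction f b) 0 i j =
    'D_(tnth b i) (fun x => dotp (gradient f x) (tnth b j)) 0.
Proof.
move=> /nbhs_ballP[d /= d0 df] i j; rewrite mxE.
pose phi x := dotp (gradient f x) (tnth b j).
have phiE : \forall t \near (0 : 'rV[R]_m),
    pderiv j (restriction f b) t = restriction phi b t.
  have := @near_enorm_lt R m 0 d; rewrite enorm0 => /(_ d0).
  apply: filterS => t td; rewrite pderiv_restriction derive_dotp_gradient //.
  apply: df; rewrite -ball_normE /= sub0r normrN.
  by rewrite (le_lt_trans (norm_le_enorm _)) // enorm_comb.
rewrite /pderiv in phiE *; rewrite (near_eq_derive _ phiE).
have := pderiv_restriction phi i 0; rewrite /pderiv => ->.
by rewrite (_ : \sum_k _ = 0) // big1 // => k _; rewrite mxE scale0r.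
Qed.

(** The [j]-th coordinate of the gradient of [f] vanishes at [0] by
orthogonality, and by linearity of its differential the row of coordinates
of [u] enters through the Hessian matrix of the restriction. *)
Lemma grad_onb_expansion (f : 'rV[R]_n -> R) :
  (\forall x \near (0 : 'rV[R]_n), differentiable f x) ->
  (forall i, differentiable (pderiv i f) 0) ->
  orth_to (gradient f 0) G ->
  forall eps, 0 < eps -> exists2 d : R, 0 < d & forall u, u \in G ->
    enorm u < d -> forall j,
    `|dotp (gradient f u) (tnth b j) -
      ((\row_i dotp u (tnth b i)) *m hessian (restriction f b) 0) 0 j|
      <= eps * enorm u.
Proof.
move=> df ddf f0G eps eps0.
pose phi j x := dotp (gradient f x) (tnth b j).
have dphi j : differentiable (phi j) 0.
  rewrite (_ : phi j = fun x => \sum_k pderiv k f x * (tnth b j) 0 k).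
    exact: differentiable_lincomb.
  by apply/funext => x; apply: eq_bigr => k _; rewrite mxE.
have phi_exp j : \forall u \near (0 : 'rV[R]_n),
    `|phi j u - 'd (phi j) 0 u| <= eps * `|u|.
  have /eqaddoP /(_ eps eps0) := diff_locally (dphi j).
  apply: filterS => u.
  have -> : (phi j \o shift 0 - (cst (phi j 0) + 'd (phi j) 0)) u =
      phi j u - 'd (phi j) 0 u.
    rewrite -![(_ + _ : _ -> _) _]/(_ + _) -![(- _ : _ -> _) _]/(- _) /=.
    by rewrite addr0 /phi f0G ?add0r // onb_mem.
  by [].
have : \forall u \near (0 : 'rV[R]_n),
    forall j, `|phi j u - 'd (phi j) 0 u| <= eps * `|u|.
  apply: (@filter_forall _ 'I_m
    (fun j u => `|phi j u - 'd (phi j) 0 u| <= eps * `|u|)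
    (nbhs (0 : 'rV[R]_n)) _ phi_exp).
case/nbhs_ballP => d /= d0 near0; exists d => // u uG ud j.
have -> : ((\row_i dotp u (tnth b i)) *m hessian (restriction f b) 0) 0 j =
    'd (phi j) 0 u.
  rewrite {2}(onb_decomp uG) linear_sum mxE /=; apply: eq_bigr => i _.
  rewrite linearZ /= mxE hessian_restriction // deriveE; first by [].
  exact: dphi.
apply: le_trans (_ : eps * `|u| <= _); last first.
  by rewrite ler_wpM2l ?norm_le_enorm // ltW.
apply: near0; rewrite -ball_normE /= sub0r normrN.
exact: le_lt_trans (norm_le_enorm _) ud.
Qed.

End OrthonormalBasis.

(** * Steepness *)

Lemma enorm_proj_grad_ge (R : realType) n m (G : {vspace 'rV[R]_n})
    (b : m.-tuple 'rV[R]_n) (f : 'rV[R]_n -> R) :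
  orthonormal_basis G b ->
  (\forall x \near (0 : 'rV[R]_n), differentiable f x) ->
  (forall i, differentiable (pderiv i f) 0) ->
  orth_to (gradient f 0) G ->
  ~~ eigenvalue (hessian (restriction f b) 0) 0 ->
  exists kappa d : R, [/\ 0 < kappa, 0 < d & forall u, u \in G ->
    enorm u < d -> kappa * enorm u <= enorm (orth_proj G (gradient f u))].
Proof.
move=> hb df ddf f0G /enorm_le_mulmx[c c0 cH].
(* With the error [(2 * K)^-1 * enorm u] on each coordinate, the bound on [u]
   given by [c] contains at most half of [enorm u] on its right-hand side. *)
pose K := c * m.+1%:R; have K0 : 0 < K by rewrite mulr_gt0.
have e0 : 0 < (2 * K)^-1 by rewrite invr_gt0 mulr_gt0.
have [d d0 near0] := grad_onb_expansion hb df ddf f0G e0.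
exists (2 * K)^-1, d; split=> // u uG ud; rewrite (enorm_orth_proj hb).
set P := \row_i dotp (gradient f u) (tnth b i).
pose t := \row_i dotp u (tnth b i).
have tu : enorm t = enorm u.
  rewrite -(enorm_comb hb) [in RHS](onb_decomp hb uG); congr enorm.
  by apply: eq_bigr => i _; rewrite mxE.
have tH : enorm (t *m hessian (restriction f b) 0) <=
    m.+1%:R * (enorm P + (2 * K)^-1 * enorm u).
  apply: le_trans (enorm_le_sum _) _.
  apply: le_trans (_ : \sum_(j < m) (enorm P + (2 * K)^-1 * enorm u) <= _).
    apply: ler_sum => j _; have := near0 u uG ud j; rewrite distrC => hj.
    have := coord_le_enorm P j; rewrite mxE => hP.
    set a := dotp _ _ in hj hP; rewrite -(subrK a (_ 0 j)).
    by apply: le_trans (ler_normD _ _) _; rewrite addrC lerD.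
  rewrite sumr_const card_ord -[leLHS]mulr_natl ler_wpM2r ?ler_nat //.
  by rewrite addr_ge0 ?enorm_ge0 // mulr_ge0 ?enorm_ge0 // ltW.
have := cH t; rewrite tu => /le_trans /(_ (ler_wpM2l (ltW c0) tH)).
rewrite mulrA -/K mulrDr mulrA.
have -> : K * (2 * K)^-1 = 2^-1 by field; rewrite gt_eqF.
move=> u_le; rewrite mulrC ler_pdivrMr ?mulr_gt0 //.
lra.
Qed.

(** Every sphere of [G] of radius at most [xi] gives a member of the set whose
supremum is taken; the member given by radius [xi] is at least [kappa *
xi]. Halving [kappa] makes the inequality strict, and halving [d] keeps
the closed range of [xi] inside the open ball of the hypothesis. *)
Lemma steep_on_of_linear_bound (R : realType) n (f : 'rV[R]_n -> R)
    (G : {vspace 'rV[R]_n}) (e : 'rV[R]_n) (kappa d M : R) :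
  orth_to (gradient f 0) G -> e \in G -> enorm e = 1 ->
  0 < kappa -> 0 < d ->
  (forall u, u \in G -> enorm u < d ->
     kappa * enorm u <= enorm (orth_proj G (gradient f u)) <= M) ->
  steep_on f G 1.
Proof.
move=> f0G eG e1 kappa0 d0 bounds; split=> //.
have sphere (eta : R) : 0 <= eta -> eta *: e \in G /\ enorm (eta *: e) = eta.
  move=> eta0; split; first exact: memvZ.
  rewrite /enorm dotpZl dotpC dotpZl mulrA -expr2 sqrtrM ?sqr_ge0 //.
  by rewrite sqrtr_sqr ger0_norm // -/(enorm e) e1 mulr1.
exists (kappa / 2), (d / 2); split; rewrite ?divr_gt0 // => xi /andP[xi0 xid].
have xi_d : xi < d by apply: le_lt_trans xid _; lra.
rewrite powRr1 ?ltW //.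
apply: lt_le_trans (_ : kappa * xi <= _); first by nra.
apply: le_trans (_ : min_proj_grad f G xi <= _).
  apply: lb_le_inf.
    exists (enorm (orth_proj G (gradient f (xi *: e)))).
    by exists (xi *: e) => //; apply: sphere; apply: ltW.
  move=> _ [u [uG ux] <-]; have := bounds u uG; rewrite ux.
  by case/(_ xi_d)/andP.
apply: ub_le_sup; last by exists xi => //=; rewrite lexx ltW.
exists M => _ [eta /= /andP[eta0 eta_xi] <-].
have [etaG eta_norm] := sphere eta eta0.
apply: le_trans (_ : enorm (orth_proj G (gradient f (eta *: e))) <= _).
  apply: ge_inf; last by exists (eta *: e).
  by exists 0 => _ [u _ <-]; apply: enorm_ge0.
have := bounds _ etaG; rewrite eta_norm => /(_ (le_lt_trans eta_xi xi_d)).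
by case/andP.
Qed.

Lemma enorm_proj_grad_le (R : realType) n m (G : {vspace 'rV[R]_n})
    (b : m.-tuple 'rV[R]_n) (f : 'rV[R]_n -> R) (M : R) (u : 'rV[R]_n) :
  orthonormal_basis G b -> (forall i, `|pderiv i f u| <= M) ->
  enorm (orth_proj G (gradient f u)) <=
    \sum_(j < m) \sum_k M * `|tnth b j 0 k|.
Proof.
move=> hb hM; rewrite (enorm_orth_proj hb).
apply: le_trans (enorm_le_sum _) _; apply: ler_sum => j _; rewrite mxE.
apply: le_trans (ler_norm_sum _ _ _) _; apply: ler_sum => k _.
by rewrite normrM mxE ler_wpM2r.
Qed.

Theorem theoremC1 (R : realType) (r n : nat) (hr : (2 <= r)%N) (hn : (2 <= n)%N)
    (s : (n - 1).-tuple nat)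
    (hs : forall i : 'I_(n - 1), (1 <= tnth s i <= r - 1)%N)
    (h : 'rV[R]_n -> R) (hC : Cb_around0 (2 * r - 1) h)
    (hgrad : gradient h 0 != 0)
    (m : nat) (hm : (2 <= m <= n - 1)%N)
    (G : {vspace 'rV[R]_n}) (hG : Lambda0 h m G) :
  steep_on h G 1.
Proof.
have [_ h0G [b hb eig]] := hG.
have q2 : (2 <= 2 * r - 1)%N.
  rewrite leq_subRL ?muln_gt0 ?(ltnW hr) //.
  exact: leq_trans (leq_mul (leqnn 2) hr).
have [rho [rho0 dh ddh [M hM]]] := Cb_around0_C2 q2 hC.
have enorm0_rho : enorm (0 : 'rV[R]_n) < rho by rewrite enorm0.
have dh0 : \forall x \near (0 : 'rV[R]_n), differentiable h x.
  exact: filterS (near_enorm_lt enorm0_rho).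
have [kappa [d [kappa0 d0 low]]] :=
  enorm_proj_grad_ge hb dh0 (fun i => ddh i 0 enorm0_rho) h0G eig.
have m0 : (0 < m)%N by case/andP: hm => /ltnW.
apply: (@steep_on_of_linear_bound _ _ _ _ (tnth b (Ordinal m0)) kappa
  (Num.min d rho) (\sum_(j < m) \sum_k M * `|tnth b j 0 k|)) => //.
- exact: onb_mem.
- by rewrite /enorm (proj2 hb) eqxx sqrtr1.
- by rewrite lt_min d0.
move=> u uG; rewrite lt_min => /andP[ud u_rho]; rewrite low //=.
by apply: enorm_proj_grad_le => // i; apply: hM.
Qed.
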